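(* Consider the following two cases. Case 1: for each $1\le k\le n$ the cost $f_k:\mathbb{R}^d\to\mathbb{R}$ is $\mu_k$-strongly convex ($\mu_k>0$) and $L_k$-smooth; $\alpha_0=\min_{1\le k\le n}\frac{2n\pi_k}{L_k+\mu_k}$. Case 2: for each $1\le k\le n$, $f_k(x)=\frac12x^\top A_kx+B_kx$ with $A_k\in\mathbb{R}^{d\times d}$ symmetric positive semidefinite and $B_k\in\mathbb{R}^{1\times d}$, and $f=\frac1n\sum_{k=1}^nf_k$ is $\mu$-strongly convex for some $\mu>0$; $\alpha_0=\min_{1\le k\le n}\frac{2n\pi_k}{L_k+\epsilon}$ for a fixed arbitrary $\epsilon>0$, where $L_k$ is the largest eigenvalue of $A_k$. In both cases the mapping $T_\alpha$ is contractive with respect to $\|\cdot\|_{\pi\otimes1_d}$ for $\alpha\in(0,\alpha_0]$. More precisely: in Case 2 there is a constant $\eta_\epsilon\in(0,1)$ with $\|T_{\alpha_0}(x)-T_{\alpha_0}(y)\|_{\pi\otimes1_d}\le\eta_\epsilon\|x-y\|_{\pi\otimes1_d}$ for all $x,y\in\mathbb{R}^{nd}$, and, setting $$C=\min_{1\le k\le n}\frac{\mu_kL_k}{n(\mu_k+L_k)\pi_k}\ \text{ in Case 1},\qquad C=\frac{1-\eta_\epsilon}{\alpha_0}\ \text{ in Case 2},$$ one has in each case, for every $\alpha\in(0,\alpha_0]$, $$\|T_\alpha(x)-T_\alpha(y)\|_{\pi\otimes1_d}\le(1-C\alpha)\|x-y\|_{\pi\otimes1_d}\qquad\forall x,y\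in\mathbb{R}^{nd}.$$
   Context: Network: $G=(V,E)$ is a strongly connected directed graph on $V=\{1,\dots,n\}$. $W=(W_{ij})$ is a real nonnegative $n\times n$ matrix with $W_{ij}>0$ if $(i,j)\in E$ or $i=j$, and $W_{ij}=0$ otherwise; $W$ is column stochastic, $\sum_{k=1}^n W_{kj}=1$ for all $j$. $\pi=(\pi_1,\dots,\pi_n)^\top$ is the right eigenvector of $W$ with $W\pi=\pi$ and $\sum_j\pi_j=1$ (all $\pi_j>0$). A function is $L$-smooth if it is differentiable with $L$-Lipschitz gradient (Euclidean norm). For $w=(w_1^\top,\dots,w_n^\top)^\top\in\mathbb{R}^{nd}$ with $w_j\in\mathbb{R}^d$, $\|w\|_{\pi\otimes1_d}=\big(\sum_{j=1}^n\frac1{\pi_j}\|w_j\|^2\big)^{1/2}$. The mapping $T_\alpha:\mathbb{R}^{nd}\to\mathbb{R}^{nd}$ has $k$-th block ($1\le k\le n$) $$(T_\alpha(w))_k=\sum_{j=1}^nW_{kj}\Big(w_j-\alpha\nabla f_j\Big(\frac{w_j}{n\pi_j}\Big)\Big)\in\mathbb{R}^d.$$ *)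

(* Defs.v *)
From HB Require Import structures.
From mathcomp Require Import all_boot all_order all_algebra.
From mathcomp Require Import all_classical all_reals all_analysis.

Set Implicit Arguments.
Unset Strict Implicit.
Unset Printing Implicit Defensive.

Import Order.TTheory GRing.Theory Num.Theory.
Import numFieldNormedType.Exports.

Local Open Scope ring_scope.

(* W is indexed so that W k j weighs what node k receives from node j; loops
   may or may not belong to E. *)
Record network (R : realType) (n : nat) (E : rel 'I_n) (W : 'M[R]_n)
    (varpi : 'cV[R]_n) : Prop := Network {
  network_strongly_connected : forall i j, connect E i j;
  network_weight_gt0 : forall i j, E i j || (i == j) -> 0 < W i j;
  network_weight_eq0 : forall i j, ~~ (E i j || (i == j)) -> W i j = 0;
  network_column_stochastic : forall j, \sum_k W k j = 1;
  network_eigenvector : W *m varpi = varpi;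
  network_eigenvector_sum1 : \sum_j varpi j 0 = 1;
  network_eigenvector_gt0 : forall j, 0 < varpi j 0
}.

(* The canonical norm `|x| on 'cV[R]_d is the sup norm. It induces
   the same topology as enorm, so differentiable and 'D_v below are the usual
   notions. *)
Definition enorm (R : realType) (d : nat) (x : 'cV[R]_d) : R :=
  Num.sqrt (\sum_i x i 0 ^+ 2).

Definition grad (R : realType) (d : nat) (f : 'cV[R]_d -> R) (x : 'cV[R]_d) :
    'cV[R]_d :=
  \col_i 'D_(delta_mx i 0) f x.

Definition smooth (R : realType) (d : nat) (L : R) (f : 'cV[R]_d -> R) : Prop :=
  (forall x, differentiable f x) /\
  (forall x y, enorm (grad f x - grad f y) <= L * enorm (x - y)).

Definition strongly_convex (R : realType) (d : nat) (mu : R)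
    (f : 'cV[R]_d -> R) : Prop :=
  forall (x y : 'cV[R]_d) (t : R), 0 <= t <= 1 ->
    f (t *: x + (1 - t) *: y) <=
      t * f x + (1 - t) * f y
      - mu / 2 * (t * (1 - t)) * enorm (x - y) ^+ 2.

Definition symmetric_psd (R : realType) (d : nat) (A : 'M[R]_d) : Prop :=
  A^T = A /\ forall x : 'cV[R]_d, 0 <= (x^T *m A *m x) 0 0.

Definition largest_eigenvalue (R : realType) (d : nat) (A : 'M[R]_d) (L : R) :
    Prop :=
  eigenvalue A L /\ forall a, eigenvalue A a -> a <= L.

Definition quadratic (R : realType) (d : nat) (A : 'M[R]_d) (B : 'rV[R]_d)
    (x : 'cV[R]_d) : R :=
  2^-1 * (x^T *m A *m x) 0 0 + (B *m x) 0 0.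

Definition average (R : realType) (n d : nat) (f : 'I_n -> 'cV[R]_d -> R)
    (x : 'cV[R]_d) : R :=
  n%:R^-1 * \sum_k f k x.

Definition min_ord (R : realType) (n : nat) (F : 'I_n.+1 -> R) : R :=
  \big[Num.min/F ord0]_k F k.

(* A vector w of R^(nd) with blocks w_1, ..., w_n in R^d is the d x n matrix
   whose j-th column is w_j. *)
Definition pi_norm (R : realType) (n d : nat) (varpi : 'cV[R]_n)
    (w : 'M[R]_(d, n)) : R :=
  Num.sqrt (\sum_j (varpi j 0)^-1 * enorm (col j w) ^+ 2).

Definition T (R : realType) (n d : nat) (W : 'M[R]_n) (varpi : 'cV[R]_n)
    (f : 'I_n -> 'cV[R]_d -> R) (alpha : R) (w : 'M[R]_(d, n)) :
    'M[R]_(d, n) :=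
  \matrix_(i, k)
    (\sum_j W k j *:
       (col j w - alpha *: grad (f j) ((n%:R * varpi j 0)^-1 *: col j w))) i 0.

Definition lipschitz_wrt (R : realType) (V : zmodType) (N : V -> R) (q : R)
    (g : V -> V) : Prop :=
  forall x y, N (g x - g y) <= q * N (x - y).

Definition contractive_wrt (R : realType) (V : zmodType) (N : V -> R)
    (g : V -> V) : Prop :=
  exists q : R, 0 <= q < 1 /\ lipschitz_wrt N q g.

(* Main.v *)
Require Import Defs.
From HB Require Import structures.
From mathcomp Require Import all_boot all_order all_algebra.
From mathcomp Require Import all_classical all_reals all_analysis.
From mathcomp Require Import ring lra.

Set Implicit Arguments.
Unset Strict Implicit.
Unset Printing Implicit Defensive.

Import Order.TTheory GRing.Theory Num.Theory.
Import numFieldNormedType.Exports.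

Local Open Scope ring_scope.

(** The map T_alpha is a blockwise gradient step followed by the mixing
    w |-> W w, and each factor is controlled separately in the pi-weighted
    inner product.

    Mixing.  Put v_j = z_j / pi_j.  By W pi = pi the k-th block of W z, divided
    by pi_k, is the mean m_k of the v_j for the probability weights
    W_kj pi_j / pi_k.  The variance identity, summed over k with column
    stochasticity, gives ([pi_dot_mix])
      |W z|^2 = |z|^2 - sum_(k,j) W_kj pi_j |v_j - m_k|^2.
    Hence mixing is nonexpansive, and since every weight W_kk is positive and
    the graph is strongly connected, equality forces all v_j to coincide
    ([network_consensus]).

    Strongly convex costs.  Comparing the quadratic lower bound given by strong
    convexity with the quadratic upper bound given by smoothness yields
      |dg|^2 + mu L |du|^2 <= (L + mu) <dg, du>
    ([gradient_cocoercive]), so that a gradient step of length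
    a <= 2 / (L + mu) contracts by 1 - a mu L / (L + mu).  For block j the step
    length is a = alpha / (n pi_j).

    Quadratic costs.  T_alpha0 x - T_alpha0 y is linear in x - y.  Since
    |A x|^2 <= L <A x, x> ([psd_mulmx_sqr]), the gradient step does not increase
    any block, and it preserves the norm of block j only if A_j w_j = 0.  If
    T_alpha0 preserves the norm of w, then w_j = pi_j v for one vector v lying
    in the kernel of every A_j; strong convexity of the average cost gives
    v = 0.  The quadratic form |w|^2 - |T_alpha0 w|^2 is thus positive definite,
    and compactness of the unit sphere ([form_min_pi_dot]) provides a uniform
    contraction factor eta.  For smaller alpha, T_alpha is a convex combination
    of T_alpha0 and of the nonexpansive mixing map, and the triangle inequality
    concludes. *)

(** * Symmetric bilinear forms *)

(** Linearity is required in the first argument only; symmetry transfers it to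
    the second. *)
Record symmetric_form (R : realType) (V : lmodType R) (B : V -> V -> R) :
    Prop := SymmetricForm {
  formC : forall x y, B x y = B y x;
  formP : forall a x y z, B (a *: x + y) z = a * B x z + B y z
}.

(** A possibly degenerate inner product: B x x = 0 does not force x = 0. *)
Record semi_inner (R : realType) (V : lmodType R) (B : V -> V -> R) : Prop :=
  SemiInner {
    semi_inner_form :> symmetric_form B;
    semi_inner_ge0 : forall x, 0 <= B x x
  }.

Section SymmetricForm.
Context {R : realType} {V : lmodType R} {B : V -> V -> R}.
Hypothesis HB : symmetric_form B.

Lemma formD x y z : B (x + y) z = B x z + B y z.
Proof. by rewrite -[x]scale1r (formP HB) mul1r scale1r. Qed.

Lemma form0 z : B 0 z = 0.
Proof. by have := formD 0 0 z; rewrite addr0; lra. Qed.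

Lemma formZ a x z : B (a *: x) z = a * B x z.
Proof. by rewrite -[a *: x]addr0 (formP HB) form0 addr0. Qed.

Lemma form_sqrD a x y :
  B (a *: x + y) (a *: x + y) = a ^+ 2 * B x x + 2 * a * B x y + B y y.
Proof.
rewrite formD formZ !(formC HB _ (a *: x + y)).
by rewrite !formD !formZ (formC HB y x); ring.
Qed.

Lemma form_suml (I : finType) (F : I -> V) z :
  B (\sum_i F i) z = \sum_i B (F i) z.
Proof. exact: (big_morph (B^~ z) (fun x y => formD x y z) (form0 z)). Qed.

End SymmetricForm.

Section SemiInner.
Context {R : realType} {V : lmodType R} {B : V -> V -> R}.
Hypothesis HB : semi_inner B.

(** The Cauchy-Schwarz inequality. *)
Lemma semi_inner_CS x y : B x y ^+ 2 <= B x x * B y y.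
Proof.
have y0 := semi_inner_ge0 HB y; have x0 := semi_inner_ge0 HB x.
have P a : 0 <= a ^+ 2 * B x x + 2 * a * B x y + B y y.
  by rewrite -(form_sqrD HB); exact: (semi_inner_ge0 HB).
have [Bx0|Bx0] := eqVneq (B x x) 0; last first.
  have Bxp : 0 < B x x by rewrite lt0r Bx0.
  have := P (- B x y / B x x); rewrite -(ler_pM2l Bxp) mulr0.
  suff -> : B x x * ((- B x y / B x x) ^+ 2 * B x x +
     2 * (- B x y / B x x) * B x y + B y y) = B x x * B y y - B x y ^+ 2.
    by rewrite subr_ge0.
  by field.
(* When B x x = 0 the expansion is affine in a, hence negative for a suitable
   a unless B x y = 0. *)
have [->|Bxy] := eqVneq (B x y) 0; first by rewrite expr0n /= mulr_ge0.
have := P (- (B y y + 1) / (2 * B x y)).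
have -> : 2 * (- (B y y + 1) / (2 * B x y)) * B x y = - (B y y + 1).
  by field.
by rewrite Bx0 mulr0; lra.
Qed.

(** The triangle inequality for the associated seminorm. *)
Lemma semi_inner_sqrtD x y :
  Num.sqrt (B (x + y) (x + y)) <= Num.sqrt (B x x) + Num.sqrt (B y y).
Proof.
have x0 := semi_inner_ge0 HB x; have y0 := semi_inner_ge0 HB y.
have Bxy : B x y <= Num.sqrt (B x x) * Num.sqrt (B y y).
  rewrite -sqrtrM// (le_trans (ler_norm _))// -sqrtr_sqr ler_wsqrtr//.
  exact: semi_inner_CS.
rewrite -[leRHS]ger0_norm ?addr_ge0 ?sqrtr_ge0// -sqrtr_sqr ler_wsqrtr//.
rewrite -{1 2}[x]scale1r (form_sqrD HB) sqrrD !sqr_sqrtr// expr1n; lra.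
Qed.
End SemiInner.

(** * Euclidean and weighted inner products *)

(** The Euclidean inner product, whose norm is [enorm]. *)
Definition dot (R : realType) (d : nat) (x y : 'cV[R]_d) : R :=
  \sum_i x i 0 * y i 0.

Section Dot.
Context {R : realType} {d : nat}.
Implicit Types x y z : 'cV[R]_d.

Lemma dotC x y : dot x y = dot y x.
Proof. by apply: eq_bigr => i _; rewrite mulrC. Qed.

Lemma dotDl x y z : dot (x + y) z = dot x z + dot y z.
Proof. by rewrite -big_split; apply: eq_bigr => i _; rewrite mxE mulrDl. Qed.

Lemma dotZl a x z : dot (a *: x) z = a * dot x z.
Proof. by rewrite mulr_sumr; apply: eq_bigr => i _; rewrite mxE mulrA. Qed.

Lemma dot_semi_inner : semi_inner (@dot R d).
Proof.
split=> [|x].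
  split=> [x y|a x y z]; first exact: dotC.
  by rewrite dotDl dotZl.
by apply: sumr_ge0 => i _; rewrite -expr2 sqr_ge0.
Qed.

Lemma dotDr x y z : dot z (x + y) = dot z x + dot z y.
Proof. by rewrite dotC dotDl !(dotC z). Qed.

Lemma dotZr a x z : dot z (a *: x) = a * dot z x.
Proof. by rewrite dotC dotZl (dotC z). Qed.

Lemma dotNl x z : dot (- x) z = - dot x z.
Proof. by rewrite -scaleN1r dotZl mulN1r. Qed.

Lemma dotNr x z : dot z (- x) = - dot z x.
Proof. by rewrite dotC dotNl dotC. Qed.

Lemma dot_suml (I : finType) (F : I -> 'cV[R]_d) z :
  dot (\sum_i F i) z = \sum_i dot (F i) z.
Proof.
rewrite [RHS]exchange_big; apply: eq_bigr => i _.
by rewrite summxE mulr_suml.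
Qed.

Lemma dot_ge0 x : 0 <= dot x x.
Proof. exact: (semi_inner_ge0 dot_semi_inner). Qed.

Lemma dot_eq0 x : dot x x = 0 -> x = 0.
Proof.
move=> /eqP; rewrite psumr_eq0 => [/allP x0|i _]; last first.
  by rewrite -expr2 sqr_ge0.
apply/colP => i; rewrite mxE; apply/eqP.
by have := x0 i (mem_index_enum i); rewrite mulf_eq0 orbb.
Qed.

Lemma enorm_sqr x : enorm x ^+ 2 = dot x x.
Proof.
have -> : dot x x = \sum_i x i 0 ^+ 2 by apply: eq_bigr => i _; rewrite expr2.
by rewrite sqr_sqrtr// sumr_ge0// => i _; rewrite sqr_ge0.
Qed.

Lemma dot_const1_gt0 :
  (0 < d)%N -> 0 < dot (const_mx 1 : 'cV[R]_d) (const_mx 1).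
Proof.
move=> d0; rewrite lt0r dot_ge0 andbT.
apply/eqP => /dot_eq0/colP/(_ (Ordinal d0)).
by rewrite !mxE; apply/eqP; rewrite oner_eq0.
Qed.

Lemma dot_mx x y : (x^T *m y) 0 0 = dot x y.
Proof. by rewrite mxE; apply: eq_bigr => i _; rewrite mxE. Qed.

Lemma dot_mulmxl (A : 'M[R]_d) x y : dot (A *m x) y = dot x (A^T *m y).
Proof. by rewrite -!dot_mx trmx_mul mulmxA. Qed.

End Dot.

Definition dotE (R : realType) (d : nat) :=
  (@dotDl R d, @dotDr R d, @dotZl R d, @dotZr R d, @dotNl R d, @dotNr R d).

Lemma enorm_ge0 (R : realType) d (x : 'cV[R]_d) : 0 <= enorm x.
Proof. exact: sqrtr_ge0. Qed.

Lemma dot_le_enorm (R : realType) d (x y : 'cV[R]_d) :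
  dot x y <= enorm x * enorm y.
Proof.
rewrite (le_trans (ler_norm _))// -[leRHS]ger0_norm ?mulr_ge0 ?enorm_ge0//.
rewrite -!sqrtr_sqr ler_wsqrtr// exprMn !enorm_sqr.
exact: (semi_inner_CS dot_semi_inner).
Qed.

Lemma enormZ (R : realType) d a (x : 'cV[R]_d) :
  0 <= a -> enorm (a *: x) = a * enorm x.
Proof.
move=> a0; apply/eqP; rewrite -(@eqrXn2 _ 2) ?mulr_ge0 ?enorm_ge0//.
by rewrite exprMn !enorm_sqr dotZl dotZr mulrA expr2.
Qed.

(** The inner product whose norm is [pi_norm]. *)
Definition pi_dot (R : realType) (n d : nat) (varpi : 'cV[R]_n)
    (x y : 'M[R]_(d, n)) : R :=
  \sum_j (varpi j 0)^-1 * dot (col j x) (col j y).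

Section PiDot.
Context {R : realType} {n d : nat} {varpi : 'cV[R]_n}.
Hypothesis varpi_gt0 : forall j, 0 < varpi j 0.
Implicit Types x y w z : 'M[R]_(d, n).

Lemma pi_dot_semi_inner : semi_inner (@pi_dot R n d varpi).
Proof.
split=> [|x]; first split=> [x y|a x y z].
- by apply: eq_bigr => j _; rewrite dotC.
- rewrite mulr_sumr -big_split; apply: eq_bigr => j _ /=.
  by rewrite linearP dotDl dotZl; ring.
- by apply: sumr_ge0 => j _; rewrite mulr_ge0 ?dot_ge0 ?invr_ge0 ?ltW.
Qed.

Lemma pi_normE w : pi_norm varpi w = Num.sqrt (pi_dot varpi w w).
Proof. by congr Num.sqrt; apply: eq_bigr => j _; rewrite enorm_sqr. Qed.

Lemma pi_normD x y :
  pi_norm varpi (x + y) <= pi_norm varpi x + pi_norm varpi y.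
Proof. by rewrite !pi_normE; exact: semi_inner_sqrtD pi_dot_semi_inner _ _. Qed.

Lemma pi_normZ a x : 0 <= a -> pi_norm varpi (a *: x) = a * pi_norm varpi x.
Proof.
move=> a0; rewrite !pi_normE (formZ pi_dot_semi_inner).
rewrite (formC pi_dot_semi_inner) (formZ pi_dot_semi_inner) mulrA.
by rewrite sqrtrM ?mulr_ge0// -expr2 sqrtr_sqr ger0_norm.
Qed.

Lemma pi_norm_le q x y : 0 <= q ->
  pi_dot varpi x x <= q ^+ 2 * pi_dot varpi y y ->
  pi_norm varpi x <= q * pi_norm varpi y.
Proof.
move=> q0 xy; rewrite !pi_normE -[q]ger0_norm// -sqrtr_sqr -sqrtrM ?sqr_ge0//.
by rewrite ler_wsqrtr.
Qed.

Lemma pi_dot_le q x y :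
  (forall j, dot (col j x) (col j x) <= q * dot (col j y) (col j y)) ->
  pi_dot varpi x x <= q * pi_dot varpi y y.
Proof.
move=> xy; rewrite mulr_sumr ler_sum// => j _.
by rewrite mulrCA ler_wpM2l// invr_ge0 ltW.
Qed.

Lemma pi_dot_eq0 x : pi_dot varpi x x = 0 -> x = 0.
Proof.
move=> /eqP; rewrite psumr_eq0 => [/allP x0|j _]; last first.
  by rewrite mulr_ge0 ?dot_ge0 ?invr_ge0 ?ltW.
apply/matrixP => i j; have := x0 j (mem_index_enum j).
rewrite mulf_eq0 invr_eq0 gt_eqF//= => /eqP /dot_eq0 /colP/(_ i).
by rewrite !mxE.
Qed.

(** The squared norm lost by mixing is a sum of variances: m k is the mean of
    the v j for the weights W_kj pi_j / pi_k, which sum to 1 over j because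
    W pi = pi.  Since the columns of z are its blocks, the mixing map is
    z |-> z W^T. *)
Lemma pi_dot_mix (W : 'M[R]_n) z :
  (forall j, \sum_k W k j = 1) -> W *m varpi = varpi ->
  let v j := (varpi j 0)^-1 *: col j z in
  let m k := (varpi k 0)^-1 *: col k (z *m W^T) in
  pi_dot varpi (z *m W^T) (z *m W^T) = pi_dot varpi z z -
    \sum_k \sum_j W k j * varpi j 0 * dot (v j - m k) (v j - m k).
Proof.
move=> Wstoch Wpi v m.
have p0 j : varpi j 0 != 0 by rewrite gt_eqF.
have row_sum k : \sum_j W k j * varpi j 0 = varpi k 0.
  by rewrite -[in RHS]Wpi mxE.
have mE k : \sum_j (W k j * varpi j 0) *: v j = varpi k 0 *: m k.
  rewrite scalerA divff// scale1r; apply/colP => i.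
  rewrite summxE !mxE; apply: eq_bigr => j _; rewrite !mxE.
  by field.
have key k : \sum_j W k j * varpi j 0 * dot (v j - m k) (v j - m k) =
    \sum_j W k j * varpi j 0 * dot (v j) (v j) - varpi k 0 * dot (m k) (m k).
  transitivity (\sum_j W k j * varpi j 0 * dot (v j) (v j)
     - 2 * dot (\sum_j (W k j * varpi j 0) *: v j) (m k)
     + (\sum_j W k j * varpi j 0) * dot (m k) (m k)).
    rewrite dot_suml mulr_sumr mulr_suml -sumrB -big_split/=.
    apply: eq_bigr => j _.
    rewrite (dotZl (W k j * _)) !dotDl !dotDr !dotNl !dotNr.
    by rewrite (dotC (m k) (v j)); ring.
  by rewrite mE row_sum dotZl; ring.
rewrite (eq_bigr _ (fun k _ => key k)) sumrB exchange_big /=.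
have -> : \sum_j \sum_k W k j * varpi j 0 * dot (v j) (v j) =
    pi_dot varpi z z.
  apply: eq_bigr => j _; rewrite -!mulr_suml Wstoch dotZl dotZr.
  by field.
rewrite opprB addrC subrK; apply: eq_bigr => k _; rewrite dotZl dotZr.
by field.
Qed.

Lemma pi_dot_mix_le (W : 'M[R]_n) z :
  (forall k j, 0 <= W k j) ->
  (forall j, \sum_k W k j = 1) -> W *m varpi = varpi ->
  pi_dot varpi (z *m W^T) (z *m W^T) <= pi_dot varpi z z.
Proof.
move=> W0 Wstoch Wpi; rewrite pi_dot_mix// gerBl.
apply: sumr_ge0 => k _; apply: sumr_ge0 => j _.
by rewrite mulr_ge0 ?dot_ge0// mulr_ge0// ltW.
Qed.

End PiDot.

(** * Gradient steps for strongly convex smooth functions *)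

Section Smooth.
Context {R : realType} {d : nat}.
Implicit Types (f : 'cV[R]_d -> R) (x y v : 'cV[R]_d).

Lemma derive_grad f x v : differentiable f x -> 'D_v f x = dot (grad f x) v.
Proof.
move=> fx; rewrite deriveE//.
have -> : v = \sum_i v i 0 *: delta_mx i 0.
  apply/colP => i; rewrite summxE (bigD1 i)//= big1 => [|j ji].
    by rewrite !mxE !eqxx/= mulr1 addr0.
  by rewrite !mxE eq_sym (negPf ji) mulr0.
rewrite linear_sum; apply: eq_bigr => i _ /=.
rewrite linearZ /= mxE deriveE//; rewrite mulrC; congr (_ * _).
rewrite summxE (bigD1 i)//= big1 => [|j ji].
  by rewrite !mxE !eqxx/= mulr1 addr0.
by rewrite !mxE eq_sym (negPf ji) mulr0.
Qed.

Lemma is_derive_line f x v (t : R) : differentiable f (x + t *: v) ->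
  is_derive t 1 (fun s : R => f (x + s *: v)) (dot (grad f (x + t *: v)) v).
Proof.
move=> fx.
(* The restriction of f to the line has at t the difference quotients of f at
   x + t v in the direction v. *)
have E : (fun h : R => h^-1 *:
    (((fun s : R => f (x + s *: v)) \o shift t) (h *: (1 : R))
      - f (x + t *: v))) =
  (fun h : R => h^-1 *: ((f \o shift (x + t *: v)) (h *: v) - f (x + t *: v))).
  apply/funext => h /=; do 3!f_equal.
  by rewrite /shift/= [h *: 1]mulr1 scalerDl addrCA.
have := @diff_derivable _ _ _ f _ v fx; rewrite /derivable => dv.
split; first by rewrite /derivable E.
by rewrite -derive_grad// /derive E.
Qed.

Lemma strongly_convex_first_order f mu x y :
  strongly_convex mu f -> differentiable f x ->
  f x + dot (grad f x) (y - x) + mu / 2 * dot (y - x) (y - x) <= f y.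
Proof.
move=> sc fx; set v := y - x.
(* Divide the convexity inequality at x + h v by h and let h tend to 0+. *)
have cv : (h^-1 *: (f (x + h *: v) - f x) @[h --> (0 : R)^'+] -->
           dot (grad f x) v)%classic.
  apply: cvg_dnbhs_at_right; rewrite -derive_grad// /derive.
  have := @diff_derivable _ _ _ f _ v fx; rewrite /derivable.
  have -> // : (fun h : R => h^-1 *: ((f \o shift x) (h *: v) - f x)) =
      (fun h : R => h^-1 *: (f (x + h *: v) - f x)).
  by apply/funext => h /=; rewrite [h *: v + x]addrC.
have cr : (f y - f x - mu / 2 * (1 - h) * dot v v @[h --> (0 : R)^'+] -->
    f y - f x - mu / 2 * (1 - 0) * dot v v)%classic.
  apply: cvg_at_right_filter; apply: cvgB; first exact: cvg_cst.
  apply: cvgM; last exact: cvg_cst.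
  by apply: cvgM; [exact: cvg_cst|apply: cvgB; [exact: cvg_cst|exact: cvg_id]].
suff : dot (grad f x) v <= f y - f x - mu / 2 * (1 - 0) * dot v v by lra.
apply: (ler_cvg_to cv cr); near=> h.
have h0 : 0 < h by near: h; exact: nbhs_right_gt.
have h1 : h < 1 by near: h; exact: nbhs_right_lt.
have h01 : 0 <= h <= 1 by rewrite !ltW.
have := sc y x h h01.
have -> : h *: y + (1 - h) *: x = x + h *: v.
  by apply/colP => i; rewrite !mxE; ring.
rewrite enorm_sqr -/v => fh.
rewrite -(ler_pM2l h0) [h^-1 *: _]/GRing.scale/= mulrA divff ?gt_eqF//; lra.
Unshelve. all: by end_near. Qed.

(** The descent lemma: by the mean value theorem, phi 1 <= phi 0 for the
    auxiliary function phi below. *)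
Lemma smooth_descent f L x y : smooth L f ->
  f y <= f x + dot (grad f x) (y - x) + L / 2 * dot (y - x) (y - x).
Proof.
move=> [df Lg]; set v := y - x.
pose c := dot (grad f x) v; pose q := dot v v.
pose phi : R -> R := (fun s : R => f (x + s *: v))
  - (c *: id + (L / 2 * q) *: (id ^+ 2)).
have dphi (t : R) : is_derive t 1 phi
    (dot (grad f (x + t *: v)) v - c - L * q * t).
  have dl := is_derive_line (df (x + t *: v)).
  have di : is_derive t 1 (@id R) 1 by exact: is_derive_id.
  have dq := is_deriveX 2 di.
  have dpoly := is_deriveD (is_deriveZ c di) (is_deriveZ (L / 2 * q) dq).
  apply: is_derive_eq (is_deriveB dl dpoly) _.
  by rewrite /GRing.scale/= /GRing.scale/=; field.
have phiE s : phi s = f (x + s *: v) - (c * s + L / 2 * q * s ^+ 2) by [].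
have [|t t01] := @MVT R phi _ 0 1 ltr01 (fun t _ => dphi t).
  by apply: derivable_within_continuous => t _; case: (dphi t).
have xv : x + v = y by rewrite /v addrC subrK.
rewrite !phiE scale1r scale0r addr0 xv -/c -/q.
suff : dot (grad f (x + t *: v)) v - c <= L * q * t by lra.
move: t01; rewrite in_itv/= => /andP[/ltW t0 _].
rewrite -dotNl -dotDl (le_trans (dot_le_enorm _ _))//.
have := Lg (x + t *: v) x; rewrite [x + _ - x]addrAC subrr add0r enormZ// => Lt.
apply: (le_trans (ler_wpM2r (enorm_ge0 _) Lt)).
by rewrite /q -enorm_sqr le_eqVlt; apply/orP; left; apply/eqP; ring.
Qed.

(** The hypothesis on d provides two distinct points at which to compare the
    lower and upper quadratic bounds. *)
Lemma strongly_convex_smooth_le f mu L : (0 < d)%N ->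
  strongly_convex mu f -> smooth L f -> mu <= L.
Proof.
move=> d0 sc sm; pose e : 'cV[R]_d := const_mx 1.
have e0 : 0 < dot e e := dot_const1_gt0 d0.
have := smooth_descent 0 e sm.
have := strongly_convex_first_order e sc (sm.1 0).
rewrite subr0 => h1 h2; rewrite -(ler_pM2r e0); lra.
Qed.

(** Cocoercivity of the gradient, sharpened by strong convexity; for mu = 0 it
    reads |dg|^2 <= L <dg, du>. *)
Lemma gradient_cocoercive f mu L x y : (0 < d)%N -> 0 <= mu ->
  strongly_convex mu f -> smooth L f ->
  dot (grad f y - grad f x) (grad f y - grad f x)
    + mu * L * dot (y - x) (y - x)
  <= (L + mu) * dot (grad f y - grad f x) (y - x).
Proof.
move=> d0 mu0 sc sm; set g := grad f y - grad f x; set u := y - x.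
have muL := strongly_convex_smooth_le d0 sc sm.
(* The quadratic lower bound at a and the upper bound at b, compared at the
   point b - t p, where p = grad f b - grad f a - mu (b - a). *)
have one_sided a b (t : R) :
    f a + dot (grad f a) (b - a) + mu / 2 * dot (b - a) (b - a)
      + (t - (L - mu) / 2 * t ^+ 2)
        * dot (grad f b - grad f a - mu *: (b - a))
              (grad f b - grad f a - mu *: (b - a)) <= f b.
  set p := grad f b - grad f a - mu *: (b - a).
  have := strongly_convex_first_order (b - t *: p) sc (sm.1 a).
  have := smooth_descent b (b - t *: p) sm.
  have -> : b - t *: p - b = - (t *: p) by rewrite addrAC subrr add0r.
  have -> : b - t *: p - a = (b - a) - t *: p by rewrite addrAC.
  set v := b - a.
  have pE : dot p p = dot (grad f b) p - dot (grad f a) p - mu * dot v p.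
    by rewrite -dotZl -!dotNl -!dotDl.
  clearbody v p.
  rewrite !dotDl !dotDr !dotNl !dotNr !dotZl !dotZr (dotC p v).
  move: pE; set pp := dot p p; nra.
have two_sided t : mu * dot u u + (2 * t - (L - mu) * t ^+ 2) *
    (dot g g - 2 * mu * dot g u + mu ^+ 2 * dot u u) <= dot g u.
  have guE : dot g u = dot (grad f y) u - dot (grad f x) u.
    by rewrite -dotNl -dotDl.
  have := one_sided x y t; have := one_sided y x t.
  rewrite -[x - y]opprB -/u -/g -[grad f x - _]opprB -/g.
  move: guE; clearbody u g => guE.
  by rewrite scalerN !dotE (dotC u g); lra.
(* For L > mu the best choice is t = 1 / (L - mu); for L = mu, monotonicity
   (t = 0) and the Lipschitz bound suffice. *)
have [Lmu|Lmu] := eqVneq L mu.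
  have gL : enorm g <= L * enorm u by exact: sm.2.
  have gg : dot g g <= L ^+ 2 * dot u u.
    rewrite -!enorm_sqr -exprMn ler_pXn2r ?nnegrE ?enorm_ge0//.
    exact: le_trans (enorm_ge0 _) gL.
  have := two_sided 0; rewrite -Lmu => gu.
  have {}gu : L * (L * dot u u) <= L * dot g u.
    by rewrite ler_wpM2l ?(le_trans mu0)//; lra.
  lra.
have Lmu0 : 0 < L - mu by rewrite subr_gt0 lt_neqAle eq_sym Lmu.
have := two_sided (L - mu)^-1.
have -> : 2 * (L - mu)^-1 - (L - mu) * (L - mu)^-1 ^+ 2 = (L - mu)^-1.
  by field; rewrite gt_eqF.
rewrite -(ler_pM2l Lmu0) mulrDr mulrA (mulrA _ _^-1) divff ?gt_eqF//; lra.
Qed.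

(** By cocoercivity, the squared distance shrinks by 1 - 2 a k, where
    k = mu L / (mu + L), and 1 - 2 a k <= (1 - a k)^2. *)
Lemma gradient_step_contracts f mu L a x y : (0 < d)%N -> 0 < mu ->
  strongly_convex mu f -> smooth L f -> 0 <= a <= 2 / (L + mu) ->
  dot ((x - y) - a *: (grad f x - grad f y))
      ((x - y) - a *: (grad f x - grad f y))
  <= (1 - a * (mu * L / (mu + L))) ^+ 2 * dot (x - y) (x - y).
Proof.
move=> d0 mu0 sc sm /andP[a0 aL].
have muL := strongly_convex_smooth_le d0 sc sm.
have Lm0 : 0 < L + mu by lra.
have := gradient_cocoercive y x d0 (ltW mu0) sc sm.
set g := grad f x - grad f y; set u := x - y; clearbody g u => co.
rewrite !dotE (dotC u g).
set k := mu * L / (mu + L).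
have kE : k * (L + mu) = mu * L by rewrite /k; field; rewrite gt_eqF// addrC.
clearbody k.
have aL2 : a * (L + mu) <= 2 by rewrite -ler_pdivlMr.
have gu : (L + mu)^-1 * dot g g + k * dot u u <= dot g u.
  rewrite -(ler_pM2l Lm0) mulrDr !mulrA divff ?gt_eqF// mul1r.
  by rewrite [(L + mu) * k]mulrC kE.
have gg := dot_ge0 g; have uu := dot_ge0 u.
have ag : a * (a * dot g g) <= a * (2 * (L + mu)^-1 * dot g g).
  by rewrite ler_wpM2l// ler_wpM2r.
have agu : a * ((L + mu)^-1 * dot g g + k * dot u u) <= a * dot g u.
  by rewrite ler_wpM2l.
have : 0 <= (a * k) ^+ 2 * dot u u by rewrite mulr_ge0 ?sqr_ge0.
lra.
Qed.
End Smooth.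

(** * Minimum of a quadratic form on a sphere *)

Section Compactness.
Context {R : realType} {d n : nat}.
Local Open Scope classical_set_scope.

Lemma continuous_form_vec (B : 'M[R]_(d, n) -> 'M[R]_(d, n) -> R) :
  symmetric_form B ->
  continuous (fun v : 'rV[R]_(d * n) => B (vec_mx v) (vec_mx v)).
Proof.
move=> HB.
have E v : B (vec_mx v) (vec_mx v) = \sum_i \sum_j \sum_k \sum_l
    v 0 (mxvec_index i j) * (v 0 (mxvec_index k l) *
      B (delta_mx k l) (delta_mx i j)).
  rewrite {1}[vec_mx v]matrix_sum_delta (form_suml HB).
  apply: eq_bigr => i _; rewrite (form_suml HB); apply: eq_bigr => j _.
  rewrite (formZ HB) mxE (formC HB) {1}[vec_mx v]matrix_sum_delta.
  rewrite (form_suml HB) mulr_sumr; apply: eq_bigr => k _.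
  rewrite (form_suml HB) mulr_sumr; apply: eq_bigr => l _.
  by rewrite (formZ HB) mxE.
rewrite (funext E).
have cv k : continuous (fun v : 'rV[R]_(d * n) => v 0 k).
  exact: coord_continuous.
have ct k l (a : R) :
    continuous (fun v : 'rV[R]_(d * n) => v 0 k * (v 0 l * a)).
  move=> v; apply: (@cvgM _ _ (nbhs v)); first exact: cv.
  by apply: (@cvgM _ _ (nbhs v)); [exact: cv|exact: cvg_cst].
do 4![apply: continuous_big => [|? _]; first exact: add_continuous].
exact: ct.
Qed.

(** The minimum c of B on the unit sphere of [pi_dot] is attained at some w0;
    matrices are flattened to row vectors, where the sphere is a closed subset
    of a box of coordinates. *)
Lemma form_min_pi_dot (varpi : 'cV[R]_n)
    (B : 'M[R]_(d, n) -> 'M[R]_(d, n) -> R) :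
  (0 < d)%N -> (0 < n)%N -> (forall j, 0 < varpi j 0) -> symmetric_form B ->
  exists c w0, [/\ w0 != 0, B w0 w0 = c * pi_dot varpi w0 w0 &
    forall w, c * pi_dot varpi w w <= B w w].
Proof.
move=> d0 n0 varpi0 HB.
have HP := pi_dot_semi_inner (d := d) varpi0.
pose S := [set v : 'rV[R]_(d * n) | pi_dot varpi (vec_mx v) (vec_mx v) = 1].
(* An entry of a unit vector in column j has square at most pi_j <= b <= b^2. *)
pose b := 1 + \sum_j varpi j 0.
have b1 : 1 <= b by rewrite lerDl sumr_ge0// => j _; rewrite ltW.
have normalize w : pi_dot varpi w w != 0 ->
    S (mxvec ((Num.sqrt (pi_dot varpi w w))^-1 *: w)).
  move=> w0; have wp : 0 < pi_dot varpi w w.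
    by rewrite lt0r w0 (semi_inner_ge0 HP).
  rewrite /S /= mxvecK (formZ HP) (formC HP) (formZ HP) mulrA -expr2.
  by rewrite exprVn sqr_sqrtr ?mulVf// ltW.
have S0 : S !=set0.
  pose e : 'M[R]_(d, n) := const_mx 1.
  exists (mxvec ((Num.sqrt (pi_dot varpi e e))^-1 *: e)); apply: normalize.
  apply/eqP => /(pi_dot_eq0 varpi0)/matrixP/(_ (Ordinal d0) (Ordinal n0)).
  by rewrite !mxE; apply/eqP; rewrite oner_eq0.
have Sclosed : closed S.
  apply: (@preimage_closed _ _ _ [set x : R | x = 1]); last exact: closed_eq.
  by move=> v _; apply: continuous_form_vec; exact: HP.
have Sbounded v : S v -> forall k, `|v 0 k| <= b.
  move=> Sv k; case: (mxvec_indexP k) => i j.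
  have -> : v 0 (mxvec_index i j) = vec_mx v i j by rewrite mxE.
  set w := vec_mx v; have w1 : pi_dot varpi w w = 1 by [].
  have wj : (varpi j 0)^-1 * w i j ^+ 2 <= 1.
    rewrite -w1 /pi_dot (bigD1 j)//= ler_wpDr//.
      by apply: sumr_ge0 => l _; rewrite mulr_ge0 ?dot_ge0// invr_ge0 ltW.
    rewrite ler_wpM2l ?invr_ge0 ?(ltW (varpi0 j))// /dot (bigD1 i)//= !mxE.
    rewrite -expr2 lerDl; apply: sumr_ge0 => l _.
    by rewrite -expr2 sqr_ge0.
  rewrite -(@ler_pXn2r _ 2) ?nnegrE// ?(le_trans ler01)//.
  rewrite real_normK ?num_real//.
  have : w i j ^+ 2 <= varpi j 0.
    by move: wj; rewrite ler_pdivrMl// mulr1.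
  move/le_trans; apply; apply: (@le_trans _ _ b); last first.
    by rewrite expr2 ler_peMl// (le_trans ler01).
  rewrite /b (bigD1 j)//= addrCA lerDl addr_ge0// sumr_ge0// => l _.
  by rewrite ltW.
have Scompact : compact S.
  apply: (@subclosed_compact _ _ [set v : 'rV[R]_(d * n) |
      forall k, `[- b, b]%classic (v ord0 k)]) => //.
    apply: (@rV_compact _ _ (fun=> `[- b, b]%classic)) => _.
    exact: segment_compact.
  by move=> v Sv k; rewrite /= in_itv/= -ler_norml; exact: Sbounded.
have [v0 + vmin] := compact_EVT_min S0 Scompact
  (continuous_subspaceT (continuous_form_vec HB)).
rewrite inE => Sv0; exists (B (vec_mx v0) (vec_mx v0)), (vec_mx v0); split.
- apply/eqP => v00; move: Sv0; rewrite /S /= v00 (form0 HP); apply/eqP.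
  by rewrite eq_sym oner_eq0.
- by rewrite (_ : pi_dot _ _ _ = 1)// mulr1.
move=> w; have [w0|w0] := eqVneq (pi_dot varpi w w) 0.
  by rewrite (pi_dot_eq0 varpi0 w0) (form0 HP) (form0 HB) mulr0.
have := vmin _ (mem_set (normalize w w0)).
have wp : 0 < pi_dot varpi w w by rewrite lt0r w0 (semi_inner_ge0 HP).
rewrite mxvecK (formZ HB) (formC HB) (formZ HB) mulrA -expr2.
by rewrite exprVn sqr_sqrtr ?(ltW wp)// ler_pdivlMl// mulrC.
Qed.

End Compactness.

(** * Quadratic costs *)

Section PsdMatrix.
Context {R : realType} {d : nat}.
Implicit Types (A : 'M[R]_d) (x y v : 'cV[R]_d).

Lemma symmetric_mx_form A : A^T = A ->
  symmetric_form (fun x y => dot (A *m x) y).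
Proof.
move=> AT; split=> [x y|a x y z]; first by rewrite dot_mulmxl AT dotC.
by rewrite mulmxDr -scalemxAr !dotE.
Qed.

Lemma psd_semi_inner A : symmetric_psd A ->
  semi_inner (fun x y => dot (A *m x) y).
Proof.
move=> [AT A0]; split=> [|x]; first exact: symmetric_mx_form.
by rewrite dotC -dot_mx mulmxA A0.
Qed.

(** The maximum M of the Rayleigh quotient is attained at some w, and the form
    M |x|^2 - <A x, x> is nonnegative and vanishes at w; by Cauchy-Schwarz
    A w = M w, so M is an eigenvalue and M <= L.  Below M is - c. *)
Lemma psd_rayleigh A L x : (0 < d)%N -> symmetric_psd A ->
  largest_eigenvalue A L -> dot (A *m x) x <= L * dot x x.
Proof.
move=> d0 Apsd [_ Lmax].
have HA := psd_semi_inner Apsd.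
have NA : symmetric_form (fun x y => - dot (A *m x) y).
  split=> [u v|a u v w]; first by rewrite (formC HA).
  by rewrite (formP HA); ring.
pose one : 'cV[R]_1 := const_mx 1.
have one0 j : 0 < one j 0 by rewrite mxE.
have oneE w : pi_dot one w w = dot w w.
  rewrite /pi_dot big_ord1 mxE invr1 mul1r.
  by congr dot; apply/colP => i; rewrite mxE.
have [c [w [w0]]] := form_min_pi_dot d0 (ltn0Sn 0) one0 NA.
rewrite oneE => cw cmin.
have HP : semi_inner (fun x y => - c * dot x y - dot (A *m x) y).
  split=> [|u]; last by have := cmin u; rewrite oneE; lra.
  split=> [u v|a u v z]; first by rewrite (formC HA) dotC.
  by rewrite (formP HA) !dotE; ring.
have Aw : A *m w = - c *: w.
  have := semi_inner_CS HP w (- c *: w - A *m w).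
  have -> : - c * dot w w - dot (A *m w) w = 0 by lra.
  rewrite mul0r -dotZl -dotNl -dotDl => /(conj (sqr_ge0 _))/andP/le_anti/eqP.
  rewrite eq_sym sqrf_eq0 => /eqP/dot_eq0/eqP.
  by rewrite subr_eq0 => /eqP.
have cL : - c <= L.
  apply: Lmax; apply/eigenvalueP; exists w^T; last by rewrite trmx_eq0.
  by rewrite -[A in LHS]Apsd.1 -trmx_mul Aw linearZ.
have := cmin x; rewrite oneE => cx.
have : - c * dot x x <= L * dot x x by rewrite ler_wpM2r ?dot_ge0.
lra.
Qed.

(** Cauchy-Schwarz for the form <A x, y>, taken at y = A x. *)
Lemma psd_mulmx_sqr A L x : (0 < d)%N -> symmetric_psd A ->
  largest_eigenvalue A L ->
  dot (A *m x) (A *m x) <= L * dot (A *m x) x.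
Proof.
move=> d0 Apsd AL; have HA := psd_semi_inner Apsd.
have := semi_inner_CS HA x (A *m x).
have := ler_wpM2l (semi_inner_ge0 HA x) (psd_rayleigh (A *m x) d0 Apsd AL).
move=> h1 /le_trans/(_ h1).
have [Ax0|Ax0] := eqVneq (dot (A *m x) (A *m x)) 0.
  by rewrite (dot_eq0 Ax0) !(form0 dot_semi_inner) mulr0.
have Ax : 0 < dot (A *m x) (A *m x) by rewrite lt0r Ax0 dot_ge0.
by rewrite expr2 mulrA ler_pM2r// mulrC.
Qed.

(** The second term on the left is the slack used in the equality case: for
    b, eps > 0 the step keeps the norm of x only if <A x, x> = 0. *)
Lemma psd_gradient_step A L b eps x : (0 < d)%N -> symmetric_psd A ->
  largest_eigenvalue A L -> 0 <= b -> b * (L + eps) <= 2 ->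
  dot (x - b *: (A *m x)) (x - b *: (A *m x)) + b ^+ 2 * eps * dot (A *m x) x
  <= dot x x.
Proof.
move=> d0 Apsd AL b0 bL.
have Ax := psd_mulmx_sqr x d0 Apsd AL.
have Ax0 := semi_inner_ge0 (psd_semi_inner Apsd) x.
rewrite !dotE (dotC x (A *m x)).
have h1 : b ^+ 2 * dot (A *m x) (A *m x) <= b ^+ 2 * (L * dot (A *m x) x).
  by rewrite ler_wpM2l ?sqr_ge0.
have h2 : b * (b * (L + eps)) * dot (A *m x) x <= b * 2 * dot (A *m x) x.
  by rewrite ler_wpM2r// ler_wpM2l.
lra.
Qed.

Lemma quadraticE A (B : 'rV[R]_d) x :
  quadratic A B x = 2^-1 * dot x (A *m x) + dot B^T x.
Proof. by rewrite /quadratic -mulmxA -[B in LHS]trmxK !dot_mx. Qed.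

Lemma grad_quadratic A (B : 'rV[R]_d) x : A^T = A ->
  grad (quadratic A B) x = A *m x + B^T.
Proof.
move=> AT.
have D v : 'D_v (quadratic A B) x = dot (A *m x + B^T) v.
  apply: cvg_lim => //.
  have lin : (dot (A *m x + B^T) v + h * (2^-1 * dot v (A *m v))
      @[h --> (0 : R)^'] -->
      dot (A *m x + B^T) v + 0 * (2^-1 * dot v (A *m v)))%classic.
    apply: cvg_within_filter; apply: cvgD; first exact: cvg_cst.
    by apply: cvgM; [exact: cvg_id|exact: cvg_cst].
  rewrite mul0r addr0 in lin.
  apply: cvg_trans lin; apply: near_eq_cvg; near=> h.
  have h0 : h != 0 by near: h; exact: nbhs_dnbhs_neq.
  rewrite /= !quadraticE mulmxDr -scalemxAr !dotE.
  rewrite (dotC x (A *m v)) [dot (A *m v) x]dot_mulmxl AT (dotC v (A *m x)).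
  by rewrite /GRing.scale/=; field.
apply/colP => i; rewrite mxE D /dot (bigD1 i)//= big1 => [|j ji].
  by rewrite [X in _ * X]mxE !eqxx mulr1 addr0.
by rewrite [X in _ * X]mxE (negPf ji) mulr0.
Unshelve. all: by end_near. Qed.

End PsdMatrix.

Section Kernel.
Context {R : realType} {d : nat}.

(** The average cost is affine on the line spanned by v, which strong convexity
    forbids unless v = 0. *)
Lemma average_quadratic_kernel n (f : 'I_n -> 'cV[R]_d -> R)
    (A : 'I_n -> 'M[R]_d) (B : 'I_n -> 'rV[R]_d) (mu : R) (v : 'cV[R]_d) :
  (forall k x, f k x = quadratic (A k) (B k) x) ->
  0 < mu -> strongly_convex mu (average f) ->
  (forall k, A k *m v = 0) -> v = 0.
Proof.
move=> fE mu0 sc Av.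
have F t : average f (t *: v) = t * average f v.
  rewrite /average mulrCA; congr (_ * _); rewrite mulr_sumr.
  apply: eq_bigr => k _; rewrite !fE !quadraticE -scalemxAr Av scaler0.
  by rewrite dotC (dotC v) !(form0 dot_semi_inner) dotZr; ring.
have F0 : average f 0 = 0 by rewrite -(scale0r v) F mul0r.
have h01 : 0 <= (2^-1 : R) <= 1 by lra.
have := sc v 0 2^-1 h01.
rewrite subr0 enorm_sqr scaler0 addr0 F F0 => h.
apply: dot_eq0; apply/eqP; rewrite eq_le dot_ge0 andbT -(ler_pM2l mu0); lra.
Qed.
End Kernel.

(** * The gradient step, mixing, and consensus *)

Section GradStep.
Context {R : realType} {n d : nat}.
Implicit Types (w x y : 'M[R]_(d, n)).

Lemma colB x y j : col j (x - y) = col j x - col j y.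
Proof. exact: linearB. Qed.

Lemma eq_col x y : (forall j, col j x = col j y) -> x = y.
Proof.
by move=> xy; apply/matrixP => i j; have /colP/(_ i) := xy j; rewrite !mxE.
Qed.

(** The blockwise gradient step, before mixing. *)
Definition grad_step (varpi : 'cV[R]_n) (f : 'I_n -> 'cV[R]_d -> R)
    (alpha : R) w : 'M[R]_(d, n) :=
  \matrix_(i, j) (col j w
    - alpha *: grad (f j) ((n%:R * varpi j 0)^-1 *: col j w)) i 0.

Lemma col_grad_step varpi f alpha w j :
  col j (grad_step varpi f alpha w) =
  col j w - alpha *: grad (f j) ((n%:R * varpi j 0)^-1 *: col j w).
Proof. by apply/colP => i; rewrite mxE [LHS]mxE. Qed.

Lemma col_grad_stepB varpi f alpha x y j :
  col j (grad_step varpi f alpha x - grad_step varpi f alpha y) =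
  (col j x - alpha *: grad (f j) ((n%:R * varpi j 0)^-1 *: col j x))
  - (col j y - alpha *: grad (f j) ((n%:R * varpi j 0)^-1 *: col j y)).
Proof. by rewrite colB; congr (_ - _); exact: col_grad_step. Qed.

Lemma T_grad_step (W : 'M[R]_n) varpi f alpha w :
  T W varpi f alpha w = grad_step varpi f alpha w *m W^T.
Proof.
apply/matrixP => i k; rewrite !mxE summxE; apply: eq_bigr => j _.
by rewrite -col_grad_step !mxE mulrC.
Qed.

Lemma grad_step_interpolate varpi f alpha alpha0 w : alpha0 != 0 ->
  grad_step varpi f alpha w =
  (1 - alpha / alpha0) *: w + (alpha / alpha0) *: grad_step varpi f alpha0 w.
Proof.
move=> a0; apply/matrixP => i j; rewrite !mxE.
by field.
Qed.

Lemma network_weight_ge0 (E : rel 'I_n) (W : 'M[R]_n) varpi :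
  network E W varpi -> forall k j, 0 <= W k j.
Proof.
move=> net k j; case Ekj : (E k j || (k == j)).
  by rewrite ltW// (network_weight_gt0 net).
by rewrite (network_weight_eq0 net)// Ekj.
Qed.

(** The norm is preserved only if the variances in [pi_dot_mix] vanish: then
    v j = m k whenever W_kj > 0.  As W_kk > 0, also v k = m k, so v is constant
    along edges, hence on the whole graph. *)
Lemma network_consensus (E : rel 'I_n) W varpi w :
  network E W varpi ->
  pi_dot varpi (w *m W^T) (w *m W^T) = pi_dot varpi w w ->
  forall j k, (varpi j 0)^-1 *: col j w = (varpi k 0)^-1 *: col k w.
Proof.
move=> net wW; have W0 := network_weight_ge0 net.
case: net => [conn Wgt0 _ Wstoch Wpi _ p0].
have := pi_dot_mix p0 w Wstoch Wpi; rewrite wW /=.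
set v := fun j => (varpi j 0)^-1 *: col j w.
set m := fun k => (varpi k 0)^-1 *: col k (w *m W^T).
rewrite -[X in X = _]subr0 => /addrI/oppr_inj/esym/eqP.
have t0 k j : 0 <= W k j * varpi j 0 * dot (v j - m k) (v j - m k).
  by rewrite mulr_ge0 ?dot_ge0// mulr_ge0// ltW.
rewrite psumr_eq0 => [|k _]; last by rewrite sumr_ge0.
move=> /allP vm0.
have vm k j : E k j || (k == j) -> v j = m k.
  move=> kj; have := vm0 k (mem_index_enum k).
  rewrite psumr_eq0// => /allP/(_ j (mem_index_enum j)).
  rewrite !mulf_eq0 gt_eqF ?Wgt0//= gt_eqF//= => /eqP/dot_eq0/eqP.
  by rewrite subr_eq0 => /eqP.
have vE k j : E k j -> v k = v j.
  by move=> kj; rewrite (vm k k) ?eqxx ?orbT// (vm k j)// kj.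
move=> j k; have /connectP[p] := conn j k.
elim: p j => [j _ -> //|l p IHp j /= /andP[jl lp] kE].
by rewrite -[LHS]/(v j) (vE j l jl); exact: IHp.
Qed.

End GradStep.

(** * The two cases *)

Section MinOrd.
Context {R : realType} {n : nat}.
Implicit Type F : 'I_n.+1 -> R.

Lemma min_ord_le F k : min_ord F <= F k.
Proof. exact: bigmin_le. Qed.

Lemma min_ord_gt F c : (forall k, c < F k) -> c < min_ord F.
Proof. by move=> cF; apply/bigmin_gtP. Qed.

End MinOrd.

Section Contraction.
Context {R : realType} {n d : nat} (E : rel 'I_n.+1) (W : 'M[R]_n.+1).
Context (varpi : 'cV[R]_n.+1) (f : 'I_n.+1 -> 'cV[R]_d -> R).
Hypothesis d0 : (0 < d)%N.
Hypothesis net : network E W varpi.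

Lemma strongly_convex_case (mu L : 'I_n.+1 -> R) :
  (forall k, 0 < mu k) ->
  (forall k, strongly_convex (mu k) (f k)) ->
  (forall k, smooth (L k) (f k)) ->
  let alpha0 := min_ord (fun k => 2 * n.+1%:R * varpi k 0 / (L k + mu k)) in
  let C := min_ord (fun k =>
    mu k * L k / (n.+1%:R * (mu k + L k) * varpi k 0)) in
  forall alpha : R, 0 < alpha <= alpha0 ->
    contractive_wrt (pi_norm varpi) (T W varpi f alpha) /\
    forall x y : 'M[R]_(d, n.+1),
      pi_norm varpi (T W varpi f alpha x - T W varpi f alpha y)
        <= (1 - C * alpha) * pi_norm varpi (x - y).
Proof.
move=> mu0 sc sm alpha0 C alpha /andP[a0 aa].
have p0 := network_eigenvector_gt0 net.
have muL k := strongly_convex_smooth_le d0 (sc k) (sm k).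
have L0 k : 0 < L k := lt_le_trans (mu0 k) (muL k).
have Lmu0 k : 0 < L k + mu k by rewrite addr_gt0.
pose P k : R := n.+1%:R * varpi k 0.
have P0 k : 0 < P k by rewrite mulr_gt0// ltr0Sn.
have C0 : 0 < C.
  apply: min_ord_gt => k; rewrite divr_gt0// ?mulr_gt0// ?ltr0Sn//.
  by rewrite addrC.
(* A gradient step of length a for f_k contracts by 1 - a kap_k; as block k is
   scaled by P_k = n pi_k, C is the least kap_k / P_k. *)
pose kap k := mu k * L k / (mu k + L k).
have Ck k : C <= (P k)^-1 * kap k.
  apply: (le_trans (min_ord_le _ k)); rewrite le_eqVlt; apply/orP; left.
  apply/eqP; rewrite /P /kap; field.
  by rewrite !gt_eqF// ?ltr0Sn// addrC.
have ak k : alpha / P k <= 2 / (L k + mu k).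
  rewrite ler_pdivrMr//; apply: (le_trans aa).
  apply: (le_trans (min_ord_le _ k)).
  by rewrite le_eqVlt; apply/orP; left; apply/eqP; rewrite /P; ring.
have ak1 k : alpha / P k * kap k <= 2^-1.
  have kap0 : 0 <= kap k by rewrite /kap divr_ge0 ?mulr_ge0 ?addr_ge0// ltW.
  apply: (le_trans (ler_wpM2r kap0 (ak k))).
  rewrite /kap (addrC (mu k)) mulf_div ler_pdivrMr ?mulr_gt0//.
  have := sqr_ge0 (L k - mu k); lra.
have q0 : 0 < 1 - C * alpha.
  have := ler_wpM2l (ltW a0) (Ck ord0); have := ak1 ord0; lra.
have stepE x y j :
    col j (grad_step varpi f alpha x - grad_step varpi f alpha y) =
    (col j x - alpha *: grad (f j) ((P j)^-1 *: col j x))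
    - (col j y - alpha *: grad (f j) ((P j)^-1 *: col j y)).
  exact: col_grad_stepB.
have lip x y : pi_norm varpi (T W varpi f alpha x - T W varpi f alpha y)
          <= (1 - C * alpha) * pi_norm varpi (x - y).
  apply: pi_norm_le => //; first exact: ltW.
  rewrite !T_grad_step -mulmxBl.
  apply: (le_trans (pi_dot_mix_le p0 _ (network_weight_ge0 net)
    (network_column_stochastic net) (network_eigenvector net))).
  apply: pi_dot_le => // j; rewrite stepE (colB x y).
  set u := _^-1 *: col j x; set v := _^-1 *: col j y.
  have xE : col j x = P j *: u by rewrite scalerA divff ?gt_eqF// scale1r.
  have yE : col j y = P j *: v by rewrite scalerA divff ?gt_eqF// scale1r.
  clearbody u v.
  have aj : 0 <= alpha / P j <= 2 / (L j + mu j).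
    by rewrite ak andbT divr_ge0// ltW.
  have := gradient_step_contracts u v d0 (mu0 j) (sc j) (sm j) aj.
  have -> : col j x - alpha *: grad (f j) u - (col j y - alpha *: grad (f j) v)
     = P j *: ((u - v) - (alpha / P j) *: (grad (f j) u - grad (f j) v)).
    rewrite xE yE; apply/colP => i; rewrite !mxE.
    by field; rewrite gt_eqF.
  rewrite xE yE -scalerBr !dotZl !dotZr -/(kap j).
  set s := (u - v - _); clearbody s => step.
  rewrite [leRHS]mulrCA ler_wpM2l ?(ltW (P0 j))// [leRHS]mulrCA.
  rewrite ler_wpM2l ?(ltW (P0 j))//; apply: (le_trans step).
  rewrite ler_wpM2r ?dot_ge0// ler_pXn2r ?nnegrE//.
  - by have := ler_wpM2l (ltW a0) (Ck j); lra.
  - by have := ak1 j; lra.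
  - exact: ltW.
split=> //; exists (1 - C * alpha); split=> //.
by rewrite (ltW q0) /= gtrBl mulr_gt0.
Qed.

Lemma pi_norm_mixB_le (x y : 'M[R]_(d, n.+1)) :
  pi_norm varpi (x *m W^T - y *m W^T) <= pi_norm varpi (x - y).
Proof.
rewrite -mulmxBl -[leRHS]mul1r; apply: pi_norm_le => //.
rewrite expr1n mul1r; apply: pi_dot_mix_le.
- exact: network_eigenvector_gt0 net.
- exact: network_weight_ge0 net.
- exact: network_column_stochastic net.
- exact: network_eigenvector net.
Qed.

Lemma quadratic_case (A : 'I_n.+1 -> 'M[R]_d) (B : 'I_n.+1 -> 'rV[R]_d)
      (L : 'I_n.+1 -> R) (mu eps : R) :
  (forall k, symmetric_psd (A k)) ->
  (forall k x, f k x = quadratic (A k) (B k) x) ->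
  0 < mu ->
  strongly_convex mu (average f) ->
  (forall k, largest_eigenvalue (A k) (L k)) ->
  0 < eps ->
  let alpha0 := min_ord (fun k => 2 * n.+1%:R * varpi k 0 / (L k + eps)) in
  exists eta : R,
    [/\ 0 < eta < 1,
        forall x y : 'M[R]_(d, n.+1),
          pi_norm varpi (T W varpi f alpha0 x - T W varpi f alpha0 y)
            <= eta * pi_norm varpi (x - y)
      & let C := (1 - eta) / alpha0 in
        forall alpha : R, 0 < alpha <= alpha0 ->
          contractive_wrt (pi_norm varpi) (T W varpi f alpha) /\
          forall x y : 'M[R]_(d, n.+1),
            pi_norm varpi (T W varpi f alpha x - T W varpi f alpha y)
              <= (1 - C * alpha) * pi_norm varpi (x - y)].
Proof.
move=> Apsd fE mu0 sc AL eps0 alpha0.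
have p0 := network_eigenvector_gt0 net.
(* Any nonzero vector e, to compare 0 <= <A e, e> <= L |e|^2. *)
pose e : 'cV[R]_d := const_mx 1.
have e0 : 0 < dot e e := dot_const1_gt0 d0.
have L0 k : 0 <= L k.
  rewrite -(ler_pM2r e0) mul0r.
  apply: le_trans (psd_rayleigh e d0 (Apsd k) (AL k)).
  exact: (semi_inner_ge0 (psd_semi_inner (Apsd k))).
have Le0 k : 0 < L k + eps by rewrite ltr_wpDl.
pose P k : R := n.+1%:R * varpi k 0.
have P0 k : 0 < P k by rewrite mulr_gt0// ltr0Sn.
have a0 : 0 < alpha0.
  by apply: min_ord_gt => k; rewrite divr_gt0// ?mulr_gt0// ?ltr0Sn.
pose b k := alpha0 / P k.
have b0 k : 0 < b k by rewrite divr_gt0.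
have bL k : b k * (L k + eps) <= 2.
  rewrite -ler_pdivlMr// ler_pdivrMr//; apply: (le_trans (min_ord_le _ k)).
  by rewrite le_eqVlt; apply/orP; left; apply/eqP; rewrite /P; ring.
(* The linear part of the gradient step: b j = alpha0 / (n pi_j). *)
pose G (w : 'M[R]_(d, n.+1)) : 'M[R]_(d, n.+1) :=
  \matrix_(i, j) (col j w - b j *: (A j *m col j w)) i 0.
have colG w j : col j (G w) = col j w - b j *: (A j *m col j w).
  by apply/colP => i; rewrite mxE [LHS]mxE.
have GP a u w : G (a *: u + w) = a *: G u + G w.
  apply/matrixP => i j; rewrite mxE linearP mulmxDr -scalemxAr !mxE; ring.
have stepE x y j :
    col j (grad_step varpi f alpha0 x - grad_step varpi f alpha0 y) =
    (col j x - alpha0 *: grad (f j) ((P j)^-1 *: col j x))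
    - (col j y - alpha0 *: grad (f j) ((P j)^-1 *: col j y)).
  exact: col_grad_stepB.
have stepG x y :
    grad_step varpi f alpha0 x - grad_step varpi f alpha0 y = G (x - y).
  apply: eq_col => j; rewrite colG stepE (colB x y).
  rewrite (funext (fE j)) !grad_quadratic ?(Apsd j).1// -!scalemxAr mulmxBr /b.
  apply/colP => i; rewrite !mxE; field.
  by rewrite gt_eqF.
have HP := pi_dot_semi_inner (d := d) p0.
(* Q w w is the squared norm lost by the linear part of T_alpha0. *)
pose Q (u w : 'M[R]_(d, n.+1)) :=
  pi_dot varpi u w - pi_dot varpi (G u *m W^T) (G w *m W^T).
have HQ : symmetric_form Q.
  split=> [u w|a u w z]; rewrite /Q.
    by rewrite (formC HP) (formC HP (G u *m _)).
  by rewrite GP mulmxDl -scalemxAl (formP HP) (formP HP a (G u *m _)); ring.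
(* S w bounds from below the part of that loss due to the gradient step. *)
pose S w := \sum_j (varpi j 0)^-1 *
  (b j ^+ 2 * eps * dot (A j *m col j w) (col j w)).
have S_ge0 j w : 0 <= (varpi j 0)^-1 *
    (b j ^+ 2 * eps * dot (A j *m col j w) (col j w)).
  rewrite mulr_ge0 ?invr_ge0 ?(ltW (p0 j))// mulr_ge0//.
    by rewrite mulr_ge0 ?sqr_ge0// ltW.
  exact: (semi_inner_ge0 (psd_semi_inner (Apsd j))).
have GS w : pi_dot varpi (G w) (G w) + S w <= pi_dot varpi w w.
  rewrite -big_split /=; apply: ler_sum => j _.
  rewrite -mulrDr ler_wpM2l ?invr_ge0 ?(ltW (p0 j))// colG.
  exact: psd_gradient_step (ltW (b0 j)) (bL j).
have mix (w : 'M[R]_(d, n.+1)) :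
    pi_dot varpi (w *m W^T) (w *m W^T) <= pi_dot varpi w w.
  exact: (pi_dot_mix_le p0 w (network_weight_ge0 net)
    (network_column_stochastic net) (network_eigenvector net)).
(* Without loss, S w = 0 gives A_j w_j = 0, so that the gradient step fixes w
   and mixing preserves its norm: the w_j / pi_j coincide. *)
have Q_eq0 w : Q w w <= 0 -> w = 0.
  move=> Qw; have S0 : 0 <= S w by apply: sumr_ge0.
  have Gw := GS w; have Ww := mix (G w); rewrite /Q in Qw.
  have {}S0 : S w = 0 by apply/eqP; rewrite eq_le S0 andbT; lra.
  have Aw j : A j *m col j w = 0.
    move/eqP: S0; rewrite psumr_eq0// => /allP/(_ j (mem_index_enum j)).
    have bj : b j ^+ 2 * eps != 0.
      by rewrite mulf_neq0 ?sqrf_eq0 ?lt0r_neq0.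
    rewrite mulf_eq0 invr_eq0 gt_eqF//= mulf_eq0 (negPf bj) /= => /eqP Aww.
    have := psd_mulmx_sqr (col j w) d0 (Apsd j) (AL j).
    rewrite Aww mulr0 => h; apply: dot_eq0.
    by apply/eqP; rewrite eq_le h dot_ge0.
  have Gww : G w = w.
    by apply: eq_col => j; rewrite colG Aw scaler0 subr0.
  have cons := network_consensus net (w := w).
  have {}cons : forall j k,
      (varpi j 0)^-1 *: col j w = (varpi k 0)^-1 *: col k w.
    apply: cons; apply/eqP; rewrite eq_le mix /=.
    by rewrite Gww in Qw; lra.
  have v0 : (varpi ord0 0)^-1 *: col ord0 w = 0.
    apply: (average_quadratic_kernel fE mu0 sc) => k.
    by rewrite (cons _ k) -scalemxAr Aw scaler0.
  apply/matrixP => i j; have := cons j ord0; rewrite v0 => /eqP.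
  rewrite scaler_eq0 invr_eq0 gt_eqF//= => /eqP/colP/(_ i).
  by rewrite !mxE.
have [c [w0 [w0_neq0 Qw0 Qmin]]] := form_min_pi_dot d0 (ltn0Sn n) p0 HQ.
have c0 : 0 < c.
  rewrite ltNge; apply/negP => cle0; move/eqP: w0_neq0; apply; apply: Q_eq0.
  by rewrite Qw0 mulr_le0_ge0// (semi_inner_ge0 HP).
(* eta^2 = max (1 - c) (1/4); the second term only keeps eta positive. *)
pose q := Num.max (1 - c) 4^-1; pose eta := Num.sqrt q.
have q0 : 0 < q by rewrite lt_max invr_gt0 ltr0n orbT.
have q1 : q < 1 by rewrite gt_max; apply/andP; split; lra.
have eta0 : 0 < eta by rewrite sqrtr_gt0.
have eta1 : eta < 1 by rewrite -[ltRHS]sqrtr1 ltr_sqrt.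
have lip x y : pi_norm varpi (T W varpi f alpha0 x - T W varpi f alpha0 y)
    <= eta * pi_norm varpi (x - y).
  apply: pi_norm_le; first exact: ltW.
  rewrite !T_grad_step -mulmxBl stepG sqr_sqrtr ?(ltW q0)//.
  have := Qmin (x - y); rewrite /Q => Qxy.
  have : (1 - c) * pi_dot varpi (x - y) (x - y)
      <= q * pi_dot varpi (x - y) (x - y).
    by rewrite ler_wpM2r ?(semi_inner_ge0 HP)// le_max lexx.
  lra.
exists eta; split=> //; first by rewrite eta0.
move=> C alpha /andP[al0 al1].
(* T_alpha is the t-combination of the mixing map and T_alpha0. *)
pose t := alpha / alpha0.
have t0 : 0 < t by rewrite divr_gt0.
have t1 : t <= 1 by rewrite ler_pdivrMr// mul1r.
have CE : 1 - C * alpha = (1 - t) + t * eta.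
  by rewrite /C /t; field; rewrite gt_eqF.
have lip' x y : pi_norm varpi (T W varpi f alpha x - T W varpi f alpha y)
    <= (1 - C * alpha) * pi_norm varpi (x - y).
  have -> : T W varpi f alpha x - T W varpi f alpha y =
      (1 - t) *: (x *m W^T - y *m W^T)
        + t *: (T W varpi f alpha0 x - T W varpi f alpha0 y).
    have tE w := grad_step_interpolate varpi f alpha w (lt0r_neq0 a0).
    rewrite !T_grad_step (tE x) (tE y) -/t.
    move: (grad_step _ _ _ x) (grad_step _ _ _ y) => X Y.
    by rewrite !mulmxDl -!scalemxAl !scalerBr opprD addrACA.
  apply: (le_trans (pi_normD p0 _ _)); rewrite !pi_normZ ?(ltW t0) ?subr_ge0//.
  rewrite CE [leRHS]mulrDl -(mulrA t) lerD// ler_wpM2l ?(ltW t0) ?subr_ge0//.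
  exact: pi_norm_mixB_le.
split=> //; exists (1 - C * alpha); split=> //.
rewrite CE; apply/andP; split.
  by rewrite addr_ge0 ?subr_ge0// mulr_ge0// ltW.
have : t * eta < t * 1 by rewrite ltr_pM2l.
lra.
Qed.

End Contraction.

Theorem theorem2p3 (R : realType) (n d : nat) (E : rel 'I_n.+1)
    (W : 'M[R]_n.+1) (varpi : 'cV[R]_n.+1) (f : 'I_n.+1 -> 'cV[R]_d -> R) :
  (0 < d)%N ->
  network E W varpi ->
  (forall mu L : 'I_n.+1 -> R,
    (forall k, 0 < mu k) ->
    (forall k, strongly_convex (mu k) (f k)) ->
    (forall k, smooth (L k) (f k)) ->
    let alpha0 := min_ord (fun k => 2 * n.+1%:R * varpi k 0 / (L k + mu k)) in
    let C := min_ord (fun k =>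
      mu k * L k / (n.+1%:R * (mu k + L k) * varpi k 0)) in
    forall alpha : R, 0 < alpha <= alpha0 ->
      contractive_wrt (pi_norm varpi) (T W varpi f alpha) /\
      forall x y : 'M[R]_(d, n.+1),
        pi_norm varpi (T W varpi f alpha x - T W varpi f alpha y)
          <= (1 - C * alpha) * pi_norm varpi (x - y))
  /\
  (forall (A : 'I_n.+1 -> 'M[R]_d) (B : 'I_n.+1 -> 'rV[R]_d)
      (L : 'I_n.+1 -> R) (mu eps : R),
    (forall k, symmetric_psd (A k)) ->
    (forall k x, f k x = quadratic (A k) (B k) x) ->
    0 < mu ->
    strongly_convex mu (average f) ->
    (forall k, largest_eigenvalue (A k) (L k)) ->
    0 < eps ->
    let alpha0 := min_ord (fun k => 2 * n.+1%:R * varpi k 0 / (L k + eps)) in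
    exists eta : R,
      [/\ 0 < eta < 1,
          forall x y : 'M[R]_(d, n.+1),
            pi_norm varpi (T W varpi f alpha0 x - T W varpi f alpha0 y)
              <= eta * pi_norm varpi (x - y)
        & let C := (1 - eta) / alpha0 in
          forall alpha : R, 0 < alpha <= alpha0 ->
            contractive_wrt (pi_norm varpi) (T W varpi f alpha) /\
            forall x y : 'M[R]_(d, n.+1),
              pi_norm varpi (T W varpi f alpha x - T W varpi f alpha y)
                <= (1 - C * alpha) * pi_norm varpi (x - y)]).
Proof.
move=> d0 net; split; first exact: strongly_convex_case d0 net.
exact: quadratic_case d0 net.
Qed.
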